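(* Let $\sigma$ be a countable relational signature containing a relation symbol $R$ of arity at least $2$. Let $\mathbf C$ be a class of groups such that no member of $\mathbf C$ has a subgroup isomorphic to $S(\omega)$, and suppose the trivial group belongs to $\mathbf C$. Let $\mathbf P=\{\mathcal A\in\mathbf S_\sigma:\mathrm{Aut}(\mathcal A)\cong\mathcal G\text{ for some }\mathcal G\in\mathbf C\}$. Then $\mathbf P$ is not expressible in $FO(\sigma)$; every abstract logic $L(\sigma)\geq FO(\sigma)$ that can express $\mathbf P$ fails the $\aleph_0$-compactness property; and every such logic which is moreover closed under negation has no proof system that is both sound and complete.
   Context: $\mathbf S_\sigma$ is the class of $\sigma$-structures; $\mathrm{Aut}(\mathcal A)$ is the automorphism group; $S(\omega)$ is the group of all permutations of $\omega=\{0,1,2,\dots\}$. An abstract logic over $\sigma$ is a pair $(L(\sigma),\models_{L(\sigma)})$ with $\models_{L(\sigma)}\subseteq\mathbf S_\sigma\times L(\sigma)$ isomorphism-invariant; a class $\mathbf P$ is expressed by it if some sentence is satisfied exactly by the members of $\mathbf P$; $L(\sigma)\geq FO(\sigma)$ means every first-order expressible class is $L(\sigma)$-expressible; $\aleph_0$-compactness: every countable finitely satisfiable set of sentences is satisfiable; closed under negation: each sentence has a sentence true in exactly the structures where it is false. A proof system $(\Pi,p,c)$ assigns to each $\pi\in\Pi$ a finite sequence $p(\pi)$ of premisses and a conclusion $c(\pi)$; sound: premisses semantically entail the conclusion; complete: whenever a set of sentences $\Gamma$ entails $\psi$ there is $\pi$ with conclusion $\psi$ and all premisses in $\Gamma$.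 *)

(* Defs.v *)
From mathcomp Require Import all_boot.
From Stdlib Require Import FunctionalExtensionality ProofIrrelevance.

Set Implicit Arguments.
Unset Strict Implicit.
Unset Printing Implicit Defensive.

Record signature := Signature { sym : Type; arity : sym -> nat }.

Record structure (sg : signature) := Struct {
  dom :> Type;
  dom_inh : inhabited dom;
  interp : forall s : sym sg, ('I_(arity s) -> dom) -> Prop }.

Arguments interp {sg} _ s t.

Definition is_iso (sg : signature) (A B : structure sg) (f : A -> B) : Prop :=
  bijective f /\
  forall (s : sym sg) (t : 'I_(arity s) -> A), interp A s t <-> interp B s (f \o t).

Definition isomorphic (sg : signature) (A B : structure sg) : Prop :=
  exists f : A -> B, is_iso f.

Record group := Group {
  gcar :> Type;
  gmul : gcar -> gcar -> gcar;
  gone : gcar;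
  ginv : gcar -> gcar;
  gmulA : associative gmul;
  gmul1 : left_id gone gmul;
  gmulV : left_inverse gone ginv gmul }.

Definition group_hom (G H : group) (f : G -> H) : Prop :=
  forall x y : G, f (gmul x y) = gmul (f x) (f y).

Definition group_isomorphic (G H : group) : Prop :=
  exists f : G -> H, group_hom f /\ bijective f.

Definition has_subgroup_iso_to (G H : group) : Prop :=
  exists f : H -> G, group_hom f /\ injective f.

Record perm_of (X : Type) := Perm {
  pfun : X -> X; pinv : X -> X;
  pK : cancel pfun pinv; pKV : cancel pinv pfun }.

Arguments pfun {X} p x.
Arguments pinv {X} p x.

Lemma perm_ext (X : Type) (p q : perm_of X) : pfun p =1 pfun q -> p = q.
Proof.
case: p q => f g fK gK [f' g' fK' gK'] /= Hf.
have Ef : f = f' by apply: functional_extensionality.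
subst f'.
have Eg : g = g'.
  apply: functional_extensionality => x.
  by rewrite -{1}(gK' x) fK.
subst g'.
by rewrite (proof_irrelevance _ fK fK') (proof_irrelevance _ gK gK').
Qed.

Definition perm_mul X (p q : perm_of X) : perm_of X.
Proof.
refine (@Perm X (pfun p \o pfun q) (pinv q \o pinv p) _ _).
- by move=> x /=; rewrite pK pK.
- by move=> x /=; rewrite pKV pKV.
Defined.

Definition perm_one X : perm_of X := @Perm X id id (fun _ => erefl) (fun _ => erefl).

Definition perm_inv X (p : perm_of X) : perm_of X :=
  @Perm X (pinv p) (pfun p) (@pKV X p) (@pK X p).

Lemma perm_mulA X : associative (@perm_mul X).
Proof. by move=> p q r; apply: perm_ext. Qed.

Lemma perm_mul1 X : left_id (perm_one X) (@perm_mul X).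
Proof. by move=> p; apply: perm_ext. Qed.

Lemma perm_mulV X : left_inverse (perm_one X) (@perm_inv X) (@perm_mul X).
Proof. by move=> p; apply: perm_ext => x /=; rewrite pK. Qed.

Definition Sym_group (X : Type) : group :=
  @Group (perm_of X) (@perm_mul X) (perm_one X) (@perm_inv X)
    (@perm_mulA X) (@perm_mul1 X) (@perm_mulV X).

Definition S_omega : group := Sym_group nat.

Record aut (sg : signature) (A : structure sg) := Aut {
  aperm : perm_of A;
  apres : forall (s : sym sg) (t : 'I_(arity s) -> A),
            interp A s t <-> interp A s (pfun aperm \o t) }.

Arguments aperm {sg A} a.
Arguments apres {sg A} a s t.

Lemma aut_ext sg (A : structure sg) (a b : aut A) : aperm a = aperm b -> a = b.
Proof.
case: a b => p Hp [q Hq] /= E; subst q.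
by rewrite (proof_irrelevance _ Hp Hq).
Qed.

Definition aut_mul sg (A : structure sg) (a b : aut A) : aut A.
Proof.
refine (@Aut sg A (perm_mul (aperm a) (aperm b)) _).
move=> s t; apply: iff_trans (apres b s t) _; exact: (apres a s (pfun (aperm b) \o t)).
Defined.

Definition aut_one sg (A : structure sg) : aut A :=
  @Aut sg A (perm_one A) (fun s t => iff_refl _).

Definition aut_inv sg (A : structure sg) (a : aut A) : aut A.
Proof.
refine (@Aut sg A (perm_inv (aperm a)) _).
move=> s t /=.
have E : pfun (aperm a) \o (pinv (aperm a) \o t) = t.
  by apply: functional_extensionality => i /=; rewrite pKV.
have := apres a s (pinv (aperm a) \o t); rewrite E => H.
by split => ?; apply/H.
Defined.

Lemma aut_mulA sg (A : structure sg) : associative (@aut_mul sg A).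
Proof. by move=> a b c; apply: aut_ext; apply: perm_mulA. Qed.

Lemma aut_mul1 sg (A : structure sg) : left_id (aut_one A) (@aut_mul sg A).
Proof. by move=> a; apply: aut_ext; apply: perm_mul1. Qed.

Lemma aut_mulV sg (A : structure sg) : left_inverse (aut_one A) (@aut_inv sg A) (@aut_mul sg A).
Proof. by move=> a; apply: aut_ext; apply: perm_mulV. Qed.

Definition Aut_group sg (A : structure sg) : group :=
  @Group (aut A) (@aut_mul sg A) (aut_one A) (@aut_inv sg A)
    (@aut_mulA sg A) (@aut_mul1 sg A) (@aut_mulV sg A).

Definition aut_in_class (sg : signature) (C : group -> Prop) (A : structure sg) : Prop :=
  exists G : group, C G /\ group_isomorphic (Aut_group A) G.

Arguments aut_in_class : clear implicits.

Inductive fo_formula (sg : signature) : Type :=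
| FEq : nat -> nat -> fo_formula sg
| FRel : forall s : sym sg, ('I_(arity s) -> nat) -> fo_formula sg
| FNot : fo_formula sg -> fo_formula sg
| FAnd : fo_formula sg -> fo_formula sg -> fo_formula sg
| FEx : nat -> fo_formula sg -> fo_formula sg.

Arguments FEq {sg}.
Arguments FRel {sg}.
Arguments FNot {sg}.
Arguments FAnd {sg}.
Arguments FEx {sg}.

Fixpoint fo_free (sg : signature) (v : nat) (phi : fo_formula sg) : Prop :=
  match phi with
  | FEq i j => v = i \/ v = j
  | FRel s a => exists k, a k = v
  | FNot psi => fo_free v psi
  | FAnd psi chi => fo_free v psi \/ fo_free v chi
  | FEx x psi => v <> x /\ fo_free v psi
  end.

Definition fo_sentence (sg : signature) (phi : fo_formula sg) : Prop :=
  forall v, ~ fo_free v phi.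

Fixpoint fo_eval (sg : signature) (A : structure sg) (e : nat -> A)
    (phi : fo_formula sg) : Prop :=
  match phi with
  | FEq i j => e i = e j
  | FRel s a => interp A s (e \o a)
  | FNot psi => ~ fo_eval e psi
  | FAnd psi chi => fo_eval e psi /\ fo_eval e chi
  | FEx x psi => exists a : A, fo_eval (fun y => if y == x then a else e y) psi
  end.

Arguments fo_eval {sg} A e phi.

Definition fo_sat (sg : signature) (A : structure sg) (phi : fo_formula sg) : Prop :=
  forall e : nat -> A, fo_eval A e phi.

Definition fo_expressible (sg : signature) (P : structure sg -> Prop) : Prop :=
  exists phi : fo_formula sg, fo_sentence phi /\ forall A, P A <-> fo_sat A phi.

Record abstract_logic (sg : signature) := AbsLogic {
  lsent : Type;
  lsat : structure sg -> lsent -> Prop;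
  lsat_iso : forall (A B : structure sg) (phi : lsent),
               isomorphic A B -> lsat A phi -> lsat B phi }.

Arguments lsat {sg} _ _ _.

Definition expresses (sg : signature) (L : abstract_logic sg) (P : structure sg -> Prop) : Prop :=
  exists phi : lsent L, forall A, lsat L A phi <-> P A.

Definition fo_le (sg : signature) (L : abstract_logic sg) : Prop :=
  forall phi : fo_formula sg, fo_sentence phi -> expresses L (fun A => fo_sat A phi).

Fixpoint in_list (T : Type) (x : T) (l : list T) : Prop :=
  match l with nil => False | cons y l' => x = y \/ in_list x l' end.

Definition countable_set (T : Type) (S : T -> Prop) : Prop :=
  exists f : T -> nat, forall x y, S x -> S y -> f x = f y -> x = y.

Definition satisfiable (sg : signature) (L : abstract_logic sg) (G : lsent L -> Prop) : Prop :=
  exists A : structure sg, forall phi, G phi -> lsat L A phi.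

Definition finitely_satisfiable (sg : signature) (L : abstract_logic sg)
    (G : lsent L -> Prop) : Prop :=
  forall l : list (lsent L), (forall phi, in_list phi l -> G phi) ->
    exists A : structure sg, forall phi, in_list phi l -> lsat L A phi.

Definition aleph0_compact (sg : signature) (L : abstract_logic sg) : Prop :=
  forall G : lsent L -> Prop, countable_set G -> finitely_satisfiable G -> satisfiable G.

Definition neg_closed (sg : signature) (L : abstract_logic sg) : Prop :=
  forall phi : lsent L, exists psi : lsent L, forall A, lsat L A psi <-> ~ lsat L A phi.

Definition entails (sg : signature) (L : abstract_logic sg) (G : lsent L -> Prop)
    (psi : lsent L) : Prop :=
  forall A : structure sg, (forall phi, G phi -> lsat L A phi) -> lsat L A psi.

Record proof_system (sg : signature) (L : abstract_logic sg) := ProofSystem {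
  proofs : Type;
  premisses : proofs -> list (lsent L);
  conclusion : proofs -> lsent L }.

Definition ps_sound (sg : signature) (L : abstract_logic sg) (PS : proof_system L) : Prop :=
  forall pi : proofs PS, entails (fun phi => in_list phi (premisses pi)) (conclusion pi).

Definition ps_complete (sg : signature) (L : abstract_logic sg) (PS : proof_system L) : Prop :=
  forall (G : lsent L -> Prop) (psi : lsent L), entails G psi ->
    exists pi : proofs PS, conclusion pi = psi /\ forall phi, in_list phi (premisses pi) -> G phi.

(* Main.v *)
Require Import Defs.
From mathcomp Require Import all_boot.
From mathcomp Require filter.
From Stdlib Require Import ClassicalEpsilon Classical ProofIrrelevance.
From Stdlib Require Import FunctionalExtensionality PropExtensionality Setoid ZArith Lia.

Set Implicit Arguments.
Unset Strict Implicit.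
Unset Printing Implicit Defensive.
(* Iteration on nat, rather than the Z-indexed iter exported by ZArith. *)
Local Notation iter := ssrnat.iter.

(* Writing R x y for R(x, y, x, ..., x), a point x is marked when R x x, and the
   step relation is the off-diagonal part of R.  The proof rests on a countable
   first-order theory separating P from its complement:
   - shape_axiom s: R only depends on its first two arguments and every other
     symbol is empty;
   - chain_axiom k: steps form the graph of a bijection, no step path of length
     k+1 joins two marks, and there are more than k marks.
   Every model of this theory is a disjoint union of Z-orbits, infinitely many of
   them carrying exactly one mark; permuting those orbits embeds S(omega) into
   its automorphism group, so it is not in P.  Conversely, for each N the
   integers with the successor step and marks on the multiples (N+2)p, p >= 0,
   form a rigid structure, hence a member of P, satisfying every chain_axiom k
   with k <= N.  Next, for an abstract separating theory, Los' theorem refutes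
   first-order definability and the theory refutes aleph0-compactness of any
   logic L >= FO expressing P; a sound and complete proof system for a logic
   closed under negation would yield that compactness. *)

Record nat_ultrafilter := NatUltrafilter {
  ularge :> (nat -> Prop) -> Prop;
  U_full : ularge (fun _ => True);
  U_proper : ~ ularge (fun _ => False);
  U_meet : forall A B, ularge A -> ularge B -> ularge (fun n => A n /\ B n);
  U_mono : forall A B : nat -> Prop, (forall n, A n -> B n) -> ularge A -> ularge B;
  U_ultra : forall A, ularge A \/ ularge (fun n => ~ A n) }.

Section Ultraproduct.
Variable sg : signature.
Variable M : nat -> structure sg.
Variable U : nat_ultrafilter.

Definition uprod := forall n, M n.

Definition ueq (f g : uprod) := U (fun n => f n = g n).

Lemma ueq_refl f : ueq f f.
Proof. exact: U_mono (@U_full U). Qed.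

Lemma ueq_sym f g : ueq f g -> ueq g f.
Proof. by apply: U_mono => n ->. Qed.

Lemma ueq_trans f g h : ueq f g -> ueq g h -> ueq f h.
Proof. by move=> Hfg Hgh; apply: U_mono (U_meet Hfg Hgh) => n [-> ->]. Qed.

(* The quotient of uprod by ueq, represented by the set of equivalence classes. *)
Definition uclass (f : uprod) : uprod -> Prop := ueq f.
Definition ucarrier := {S : uprod -> Prop | exists f, S = uclass f}.
Definition uproj (f : uprod) : ucarrier := exist _ (uclass f) (ex_intro _ f erefl).
Definition urep (q : ucarrier) : uprod :=
  proj1_sig (constructive_indefinite_description _ (proj2_sig q)).

Lemma uproj_eq f g : uproj f = uproj g <-> ueq f g.
Proof.
split=> [E | Hfg].
- have Ecl : uclass f = uclass g := f_equal (@proj1_sig _ _) E.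
  by have : uclass f g by rewrite Ecl; exact: ueq_refl.
- have E : uclass f = uclass g.
    apply: functional_extensionality => h; apply: propositional_extensionality.
    by split; [apply: ueq_trans (ueq_sym Hfg) | apply: ueq_trans Hfg].
  rewrite /uproj; move: (ex_intro _ f _) (ex_intro _ g _); rewrite E => p1 p2.
  by rewrite (proof_irrelevance _ p1 p2).
Qed.

Lemma urepK q : uproj (urep q) = q.
Proof.
case: q => S HS; rewrite /uproj /urep /=.
case: (constructive_indefinite_description _ _) => f /= Ef.
move: (ex_intro _ _ _); rewrite -Ef => p; by rewrite (proof_irrelevance _ p HS).
Qed.

Lemma urep_uproj f : ueq (urep (uproj f)) f.
Proof. by apply/uproj_eq; rewrite urepK. Qed.

Definition some_thread : uprod := fun n => epsilon (dom_inh (M n)) (fun _ => True).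

Definition ultraproduct : structure sg :=
  @Struct sg ucarrier (inhabits (uproj some_thread))
    (fun s t => U (fun n => interp (M n) s (fun i => urep (t i) n))).

Lemma U_not A : ~ U A <-> U (fun n => ~ A n).
Proof.
split=> [HnA | HnA HA]; first by case: (@U_ultra U A).
by case: (@U_proper U); apply: U_mono (U_meet HA HnA) => n [].
Qed.

(* The existential step chooses a witness in each factor. *)
Lemma Los (phi : fo_formula sg) (e : nat -> ultraproduct) :
  fo_eval ultraproduct e phi <-> U (fun n => fo_eval (M n) (fun v => urep (e v) n) phi).
Proof.
elim: phi e => [i j | s a | psi IH | psi IH1 chi IH2 | x psi IH] e /=.
- split=> [-> | Hij]; first exact: ueq_refl.
  by rewrite -(urepK (e i)) -(urepK (e j)); apply/uproj_eq.
- done.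
- by rewrite IH; exact: U_not.
- rewrite IH1 IH2; split=> [[H1 H2] | H]; first exact: U_meet.
  by split; apply: U_mono H => n [].
- pose Q n b := fo_eval (M n) (fun y => if y == x then b else urep (e y) n) psi.
  split=> [[q /IH Hq] | H].
  + apply: U_mono Hq => n Hq; exists (urep q n).
    by move: Hq; congr (fo_eval _ _ _); apply: functional_extensionality => v; case: (v == x).
  + pose a : uprod := fun n => epsilon (dom_inh (M n)) (Q n).
    exists (uproj a); apply/IH.
    apply: U_mono (U_meet H (urep_uproj a)) => n [[b Hb] Ea].
    have := epsilon_spec (dom_inh (M n)) (Q n) (ex_intro _ b Hb).
    by congr (fo_eval _ _ _); apply: functional_extensionality => v; case: (v == x); rewrite ?Ea.
Qed.

Lemma Los_sat (phi : fo_formula sg) :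
  U (fun n => fo_sat (M n) phi) -> fo_sat ultraproduct phi.
Proof. by move=> H e; apply/Los; apply: U_mono H => n. Qed.

End Ultraproduct.

Lemma nonprincipal_ultrafilter : exists U : nat_ultrafilter, forall N, U (fun n => N <= n).
Proof.
have [G [GU sFG]] := filter.ultraFilterLemma filter.eventually_filter.
have GP : filter.ProperFilter G := @filter.ultra_proper _ _ GU.
have GF : filter.Filter G := @filter.filter_filter _ _ GP.
pose U := @NatUltrafilter G (@filter.filterT _ G GF) (@filter.filter_not_empty _ G GP)
  (fun A B => @filter.filterI _ G GF A B) (fun A B AB => @filter.filterS _ G GF A B AB)
  (fun A => filter.in_ultra_setVsetC A GU).
by exists U => N; apply: sFG; exists N.
Qed.

Section Formulas.
Variable sg : signature.
Variable R : sym sg.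

Definition FAll x (p : fo_formula sg) := FNot (FEx x (FNot p)).
Definition FImp (p q : fo_formula sg) := FNot (FAnd p (FNot q)).
Definition FIff (p q : fo_formula sg) := FAnd (FImp p q) (FImp q p).
Definition FTrue : fo_formula sg := FEx 0 (FEq 0 0).
Arguments FAll : simpl never.
Arguments FImp : simpl never.

Definition upd (A : Type) (e : nat -> A) x (a : A) := fun y => if y == x then a else e y.

Lemma eval_FAll (A : structure sg) e x p :
  fo_eval A e (FAll x p) <-> forall a, fo_eval A (upd e x a) p.
Proof.
rewrite /FAll /=; split=> [H a | H [a Ha]]; last exact: Ha (H a).
by apply: NNPP => Hn; apply: H; exists a.
Qed.

Lemma eval_FImp (A : structure sg) e p q :
  fo_eval A e (FImp p q) <-> (fo_eval A e p -> fo_eval A e q).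
Proof.
rewrite /FImp /=; split=> [H Hp | H [Hp Hq]]; last exact: Hq (H Hp).
by apply: NNPP => Hq; exact: H.
Qed.

Lemma sat_of_eval (A : structure sg) phi (Q : Prop) :
  (forall e, fo_eval A e phi <-> Q) -> fo_sat A phi <-> Q.
Proof.
move=> H; split=> [Hphi | HQ e]; last exact/H.
by case: (dom_inh A) => a; apply/(H (fun=> a)).
Qed.

Definition pair_tuple (T : Type) n (x y : T) : 'I_n -> T :=
  fun i => if nat_of_ord i == 1 then y else x.

Lemma pair_tuple_comp (T T' : Type) (f : T -> T') n (x y : T) :
  f \o @pair_tuple T n x y = pair_tuple (f x) (f y).
Proof. by apply: functional_extensionality => i; rewrite /pair_tuple /=; case: (_ == _). Qed.

Lemma pair_tuple01_lt n (i : 'I_n) : @pair_tuple nat n 0 1 i < n.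
Proof.
rewrite /pair_tuple; case: eqP => [<- | _]; first exact: ltn_ord.
exact: leq_ltn_trans (leq0n _) (ltn_ord i).
Qed.

Definition edge (A : structure sg) (a b : A) := interp A R (pair_tuple a b).
Definition step (A : structure sg) (a b : A) := a <> b /\ edge a b.
Definition marked (A : structure sg) (a : A) := edge a a.

Definition FEdge x y : fo_formula sg := FRel R (pair_tuple x y).
Definition FStep x y : fo_formula sg := FAnd (FNot (FEq x y)) (FEdge x y).
Definition FMarked x : fo_formula sg := FEdge x x.
Arguments FStep : simpl never.
Arguments FMarked : simpl never.

Lemma eval_FEdge (A : structure sg) e x y : fo_eval A e (FEdge x y) <-> edge (e x) (e y).
Proof. by rewrite /= pair_tuple_comp. Qed.

Lemma eval_FStep (A : structure sg) e x y : fo_eval A e (FStep x y) <-> step (e x) (e y).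
Proof. by rewrite /FStep /= pair_tuple_comp. Qed.

Lemma eval_FMarked (A : structure sg) e x : fo_eval A e (FMarked x) <-> marked (e x).
Proof. exact: eval_FEdge. Qed.

Lemma free_FEdge v x y : fo_free v (FEdge x y) -> v = x \/ v = y.
Proof. by move=> /= [k]; rewrite /pair_tuple; case: (_ == _) => <-; auto. Qed.

Lemma free_FStep v x y : fo_free v (FStep x y) -> v = x \/ v = y.
Proof. by case=> H; [exact: H | exact: free_FEdge]. Qed.

Ltac solve_free := repeat match goal with
 | H : fo_free _ (FAll _ _) |- _ => destruct H as [? H]
 | H : fo_free _ (FImp _ _) |- _ => destruct H as [H | H]
 | H : fo_free _ (FAnd _ _) |- _ => destruct H as [H | H]
 | H : fo_free _ (FEx _ _) |- _ => destruct H as [? H]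
 | H : fo_free ?v (FNot ?p) |- _ => change (fo_free v p) in H
 | H : fo_free _ (FStep _ _) |- _ => apply free_FStep in H; destruct H as [H | H]; subst
 | H : fo_free _ (FEq _ _) |- _ => destruct H as [H | H]; subst
 | H : ?v <> ?v |- _ => exfalso; exact (H erefl)
 end.

Definition step_bijective (A : structure sg) :=
  [/\ forall a : A, exists b, step a b /\ forall c, step a c -> c = b,
      forall a a' b : A, step a b -> step a' b -> a = a'
    & forall b : A, exists a, step a b].

Definition FStepBijective : fo_formula sg :=
  FAnd (FAll 0 (FEx 1 (FAnd (FStep 0 1) (FAll 2 (FImp (FStep 0 2) (FEq 2 1))))))
 (FAnd (FAll 0 (FAll 1 (FAll 2 (FImp (FAnd (FStep 0 2) (FStep 1 2)) (FEq 0 1)))))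
       (FAll 0 (FEx 1 (FStep 1 0)))).

Lemma eval_FStepBijective (A : structure sg) e :
  fo_eval A e FStepBijective <-> step_bijective A.
Proof.
rewrite /FStepBijective /step_bijective.
repeat (setoid_rewrite eval_FAll || setoid_rewrite eval_FImp || setoid_rewrite eval_FStep
        || cbn [fo_eval]).
rewrite /upd /=; split=> [[H1 [H2 H3]] | [H1 H2 H3]]; split=> //.
- by move=> a a' b Hab Ha'b; exact: H2 (conj Hab Ha'b).
- by split=> // a a' b [Hab Ha'b]; exact: H2 Hab Ha'b.
Qed.

Lemma closed_FStepBijective : fo_sentence FStepBijective.
Proof. by move=> v H; rewrite /FStepBijective in H; solve_free. Qed.

(* Step paths of length j; FPath j a b uses the variables j+1, ..., 2 as
   intermediate points, hence a and b must avoid them. *)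
Fixpoint step_path (A : structure sg) j (a b : A) : Prop :=
  if j is j'.+1 then exists c, step a c /\ step_path j' c b else a = b.

Fixpoint FPath j a b : fo_formula sg :=
  if j is j'.+1 then FEx j'.+2 (FAnd (FStep a j'.+2) (FPath j' j'.+2 b)) else FEq a b.

Lemma eval_FPath (A : structure sg) j : forall a b (e : nat -> A),
  a < 2 \/ j.+1 < a -> b < 2 ->
  fo_eval A e (FPath j a b) <-> step_path j (e a) (e b).
Proof.
elim: j => [|j IH] a b e Ha Hb //=.
have Ha' : (a == j.+2) = false.
  by apply/eqP => E; move: Ha; rewrite E ltnS ltnn; case.
have Hb' : (b == j.+2) = false by apply/eqP => E; rewrite E in Hb.
have IHj := IH j.+2 b (upd e j.+2 _) (or_intror (ltnSn _)) Hb.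
rewrite /upd /= Hb' eqxx in IHj.
have Hs c : fo_eval A (upd e j.+2 c) (FStep a j.+2) <-> step (e a) c.
  by rewrite eval_FStep /upd Ha' eqxx.
by split=> -[c [/Hs Hac /IHj Hcb]]; exists c; split=> //; apply/Hs.
Qed.

Lemma free_FPath j : forall a b v, a < 2 \/ j.+1 < a -> b < 2 ->
  fo_free v (FPath j a b) -> v = a \/ v = b.
Proof.
elim: j => [|j IH] a b v Ha Hb; first done.
move=> [Hv [/free_FStep [E | E] | H]]; [by left | by case: Hv | ].
by case: (IH _ _ _ (or_intror (ltnSn j.+1)) Hb H) => E; [case: Hv | right].
Qed.

Definition no_marked_path (A : structure sg) j :=
  ~ exists a b : A, [/\ marked a, marked b & step_path j a b].

Definition FNoMarkedPath j :=
  FNot (FEx 0 (FAnd (FMarked 0) (FEx 1 (FAnd (FMarked 1) (FPath j 0 1))))).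

Lemma eval_FNoMarkedPath (A : structure sg) e j :
  fo_eval A e (FNoMarkedPath j) <-> no_marked_path A j.
Proof.
have Hp := @eval_FPath A j 0 1 _ (or_introl (isT : 0 < 2)) (isT : 1 < 2).
rewrite /FNoMarkedPath /no_marked_path /=; split=> Hn Hex; apply: Hn.
- case: Hex => a [b [Ha Hb Hab]]; exists a; split; first exact/eval_FMarked.
  by exists b; split; [exact/eval_FMarked | exact/Hp].
- case: Hex => a [/eval_FMarked Ha [b [/eval_FMarked Hb /Hp Hab]]].
  by exists a, b.
Qed.

Lemma closed_FNoMarkedPath j : fo_sentence (FNoMarkedPath j).
Proof.
move=> v [Hv0 [/free_FEdge [] // | [Hv1 [/free_FEdge [] // | H]]]].
by case: (free_FPath (or_introl (isT : 0 < 2)) (isT : 1 < 2) H).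
Qed.

Fixpoint FAllBelow n (p : fo_formula sg) :=
  if n is n'.+1 then FAllBelow n' (FAll n' p) else p.

Lemma eval_FAllBelow (A : structure sg) n : forall p (e : nat -> A),
  fo_eval A e (FAllBelow n p) <->
  forall e' : nat -> A, (forall v, n <= v -> e' v = e v) -> fo_eval A e' p.
Proof.
elim: n => [|n IH] p e /=.
- split=> [H e' He | H]; last exact: H.
  by have -> : e' = e by apply: functional_extensionality => v; apply: He.
- rewrite IH; split=> [H e' He | H e' He].
  + have Hagree v : n <= v -> upd e' n (e n) v = e v.
      rewrite /upd; case: eqP => [-> // | Hne Hv].
      by apply: He; rewrite ltn_neqAle Hv andbT; apply/eqP => E; apply: Hne.
    have := H _ Hagree; rewrite eval_FAll => /(_ (e' n)).
    have -> // : upd (upd e' n (e n)) n (e' n) = e'.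
    by apply: functional_extensionality => v; rewrite /upd; case: eqP => [-> |].
  + apply/eval_FAll => a; apply: H => v Hv; rewrite /upd.
    by case: eqP => [E | _]; [rewrite E ltnn in Hv | apply: He; apply: ltnW].
Qed.

Lemma eval_FAllBelow_inst (A : structure sg) n p (e : nat -> A) :
  fo_eval A e (FAllBelow n p) ->
  forall f : nat -> A, fo_eval A (fun v => if v < n then f v else e v) p.
Proof. by move/eval_FAllBelow=> H f; apply: H => v Hv; rewrite ltnNge Hv. Qed.

Lemma free_FAllBelow n : forall p v, fo_free v (FAllBelow n p) -> n <= v /\ fo_free v p.
Proof.
elim: n => [|n IH] p v //= /IH [H1 [H2 H3]]; split=> //.
by rewrite ltn_neqAle H1 andbT; apply/eqP => E; apply: H2.
Qed.

Fixpoint FAllMarked i :=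
  if i is i'.+1 then FAnd (FAllMarked i') (FMarked i') else FTrue.
Fixpoint FAllDistinct y i :=
  if i is i'.+1 then FAnd (FAllDistinct y i') (FNot (FEq y i')) else FTrue.

Lemma eval_FAllMarked (A : structure sg) e i :
  fo_eval A e (FAllMarked i) <-> forall j, j < i -> marked (e j).
Proof.
elim: i => [|i IH] /=; first by split=> // _; exists (e 0).
rewrite IH; split=> [[H1 /eval_FMarked H2] j | H].
- by rewrite ltnS leq_eqVlt => /orP [/eqP -> // | ]; exact: H1.
- by split; [move=> j Hj; apply/H/ltnW | apply/eval_FMarked/H].
Qed.

Lemma eval_FAllDistinct (A : structure sg) e y i :
  fo_eval A e (FAllDistinct y i) <-> forall j, j < i -> e y <> e j.
Proof.
elim: i => [|i IH] /=; first by split=> // _; exists (e 0).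
rewrite IH; split=> [[H1 H2] j | H].
- by rewrite ltnS leq_eqVlt => /orP [/eqP -> // | ]; exact: H1.
- by split; [move=> j Hj; apply/H/ltnW | apply: H].
Qed.

Lemma free_FAllMarked i v : fo_free v (FAllMarked i) -> v < i.
Proof.
elim: i => [|i IH] /=; first by case=> Hv [] E; case: Hv.
by case=> [/IH /ltnW | /free_FEdge [] ->].
Qed.

Lemma free_FAllDistinct y i v : fo_free v (FAllDistinct y i) -> v = y \/ v < i.
Proof.
elim: i => [|i IH] /=; first by case=> Hv [] E; case: Hv.
case=> [/IH [H | /ltnW H] | [H | ->]]; by [left | right].
Qed.

Definition more_marks (A : structure sg) k :=
  forall p : nat -> A, (forall j, j < k -> marked (p j)) ->
  exists a, marked a /\ forall j, j < k -> a <> p j.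

Definition FMoreMarks k :=
  FAllBelow k (FImp (FAllMarked k) (FEx k (FAnd (FMarked k) (FAllDistinct k k)))).

Lemma eval_FMoreMarks (A : structure sg) e k :
  fo_eval A e (FMoreMarks k) <-> more_marks A k.
Proof.
have Hk j : j < k -> (j == k) = false by move=> Hj; apply/eqP => E; rewrite E ltnn in Hj.
split=> [/eval_FAllBelow_inst H p Hp | H].
- have Hm j : j < k -> marked ((fun v => if v < k then p v else e v) j).
    by move=> Hj; rewrite /= Hj; exact: Hp.
  have := H p; rewrite eval_FImp eval_FAllMarked.
  case/(_ Hm)=> a [/eval_FMarked Ha /eval_FAllDistinct Hn].
  exists a; split=> [| j Hj]; first by move: Ha; rewrite /= eqxx.
  by move: (Hn j Hj); rewrite /= eqxx Hk // Hj.
- apply/eval_FAllBelow => e' _; rewrite eval_FImp eval_FAllMarked => Hm.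
  have [a [Ha Hn]] := H e' Hm; exists a; split.
  + by apply/eval_FMarked; rewrite /= eqxx.
  + by apply/eval_FAllDistinct => j Hj /=; rewrite eqxx Hk //; exact: Hn.
Qed.

Lemma closed_FMoreMarks k : fo_sentence (FMoreMarks k).
Proof.
move=> v /free_FAllBelow [Hk [/free_FAllMarked | [Hv [/free_FEdge [] // | ]]]].
- by rewrite ltnNge Hk.
- by case/free_FAllDistinct => // H; rewrite ltnNge Hk in H.
Qed.

Definition binary_shaped (A : structure sg) s := forall f : nat -> A,
  interp A s (fun i => f (nat_of_ord i)) <-> interp A s (f \o pair_tuple 0 1).
Definition empty_symbol (A : structure sg) s :=
  forall f : nat -> A, ~ interp A s (fun i => f (nat_of_ord i)).

Definition ord_first n (H : 1 < n) : 'I_n := Ordinal (ltnW H).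
Definition ord_second n (H : 1 < n) : 'I_n := Ordinal H.

Lemma tuple_as_fun (T : Type) n (t : 'I_n -> T) (x0 : T) :
  exists f : nat -> T, (fun i : 'I_n => f (nat_of_ord i)) = t.
Proof.
exists (fun v => if insub v is Some i then t i else x0).
by apply: functional_extensionality => i; rewrite valK.
Qed.

Lemma binary_shapedE (A : structure sg) s (Hs : 1 < arity s) : binary_shaped A s ->
  forall t, interp A s t <-> interp A s (pair_tuple (t (ord_first Hs)) (t (ord_second Hs))).
Proof.
move=> Hsh t; have [f <-] := tuple_as_fun t (t (ord_first Hs)).
by rewrite Hsh pair_tuple_comp.
Qed.

Lemma empty_symbolE (A : structure sg) s : empty_symbol A s -> forall t, ~ interp A s t.
Proof. by move=> Hs t; case: (dom_inh A) => a; have [f <-] := tuple_as_fun t a; exact: Hs. Qed.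

Definition FBinaryShaped s :=
  FAllBelow (arity s) (FIff (FRel s (fun i => nat_of_ord i)) (FRel s (pair_tuple 0 1))).
Definition FEmptySymbol s := FAllBelow (arity s) (FNot (FRel s (fun i => nat_of_ord i))).

Lemma inst_comp (A : Type) n (f e : nat -> A) (g : 'I_n -> nat) :
  (forall i, g i < n) -> (fun v => if v < n then f v else e v) \o g = f \o g.
Proof. by move=> Hg; apply: functional_extensionality => i /=; rewrite Hg. Qed.

Lemma sat_FBinaryShaped (A : structure sg) s :
  fo_sat A (FBinaryShaped s) <-> binary_shaped A s.
Proof.
apply: sat_of_eval => e; split=> [/eval_FAllBelow_inst H f | H].
- have := H f; rewrite /FIff; cbn [fo_eval]; rewrite !eval_FImp; cbn [fo_eval].
  rewrite !inst_comp => [[H1 H2] | i | i]; [by split | exact: pair_tuple01_lt | exact: ltn_ord].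
- apply/eval_FAllBelow => e' _; rewrite /FIff; cbn [fo_eval]; rewrite !eval_FImp.
  by split=> ?; apply/H.
Qed.

Lemma sat_FEmptySymbol (A : structure sg) s :
  fo_sat A (FEmptySymbol s) <-> empty_symbol A s.
Proof.
apply: sat_of_eval => e; split=> [/eval_FAllBelow_inst H f | H].
- by have := H f; rewrite /= inst_comp // => i; exact: ltn_ord.
- by apply/eval_FAllBelow => e' _ /=; apply: H.
Qed.

Lemma closed_FBinaryShaped s : fo_sentence (FBinaryShaped s).
Proof.
move=> v /free_FAllBelow [Hv]; rewrite /FIff /FImp /=.
by case=> [[] | []] [k Ek]; rewrite -Ek leqNgt ?ltn_ord ?pair_tuple01_lt in Hv.
Qed.

Lemma closed_FEmptySymbol s : fo_sentence (FEmptySymbol s).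
Proof. by move=> v /free_FAllBelow [Hv [k Hk]]; rewrite -Hk leqNgt ltn_ord in Hv. Qed.

Definition shape_axiom s :=
  if excluded_middle_informative (s = R) then FBinaryShaped s else FEmptySymbol s.

Definition chain_axiom k :=
  FAnd FStepBijective (FAnd (FNoMarkedPath k.+1) (FMoreMarks k)).

Lemma closed_shape_axiom s : fo_sentence (shape_axiom s).
Proof.
by rewrite /shape_axiom; case: (excluded_middle_informative (s = R)) => Hs;
   [apply: closed_FBinaryShaped | apply: closed_FEmptySymbol].
Qed.

Lemma closed_chain_axiom k : fo_sentence (chain_axiom k).
Proof.
move=> v; rewrite /chain_axiom; cbn [fo_free].
by case=> [| []]; [apply: closed_FStepBijective | apply: closed_FNoMarkedPath
                   | apply: closed_FMoreMarks].
Qed.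

Definition R_shaped (A : structure sg) :=
  binary_shaped A R /\ forall s, s <> R -> empty_symbol A s.

Lemma sat_shape_axioms (A : structure sg) :
  (forall s, fo_sat A (shape_axiom s)) <-> R_shaped A.
Proof.
rewrite /shape_axiom; split=> [H | [HR Hemp] s].
- split=> [| s Hs].
  + by move: (H R); case: (excluded_middle_informative _) => // _ /sat_FBinaryShaped.
  + by move: (H s); case: (excluded_middle_informative _) => // _ /sat_FEmptySymbol.
- case: (excluded_middle_informative _) => [Es | /Hemp /sat_FEmptySymbol //].
  by apply/sat_FBinaryShaped; rewrite Es.
Qed.

Lemma sat_chain_axiom (A : structure sg) k : fo_sat A (chain_axiom k) <->
  [/\ step_bijective A, no_marked_path A k.+1 & more_marks A k].
Proof.
apply: sat_of_eval => e.
rewrite /chain_axiom; cbn [fo_eval]; rewrite eval_FStepBijective eval_FNoMarkedPath eval_FMoreMarks.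
by split=> [[? [? ?]] | [? ? ?]].
Qed.

End Formulas.

Section RigidModels.
Variable sg : signature.
Variable R : sym sg.
Hypothesis HR : 1 < arity R.
Variable N : nat.

Definition gap : Z := (Z.of_nat N + 2)%Z.
Definition on_mark (x : Z) := exists p, (0 <= p)%Z /\ x = (gap * p)%Z.
Definition Zedge (x y : Z) := y = (x + 1)%Z \/ (x = y /\ on_mark x).

Definition rigid_model : structure sg :=
  @Struct sg Z (inhabits 0%Z) (fun s t => s = R /\
    exists i j : 'I_(arity s), [/\ nat_of_ord i = 0, nat_of_ord j = 1 & Zedge (t i) (t j)]).

Lemma edge_rigid (x y : rigid_model) : edge R x y <-> Zedge x y.
Proof.
split=> [[_ [i [j [Hi Hj]]]] | H]; first by rewrite /pair_tuple Hi Hj.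
by split=> //; exists (ord_first HR), (ord_second HR).
Qed.

Lemma step_rigid (x y : rigid_model) : step R x y <-> y = (x + 1)%Z.
Proof.
rewrite /step edge_rigid /Zedge.
by split=> [[? [// | []]] | ->]; [| split; [lia | left]].
Qed.

Lemma marked_rigid (x : rigid_model) : marked R x <-> on_mark x.
Proof. by rewrite /marked edge_rigid /Zedge; split=> [[| []] | ]; [lia | | right]. Qed.

Lemma step_path_rigid j (a b : rigid_model) : step_path R j a b <-> b = (a + Z.of_nat j)%Z.
Proof.
elim: j a b => [|j IH] a b /=; first by split=> ->; lia.
split=> [[c [/step_rigid -> /IH ->]] | ->]; first lia.
by exists (a + 1)%Z; split; [apply/step_rigid | apply/IH; lia].
Qed.

Lemma rigid_step_bijective : step_bijective R rigid_model.
Proof.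
split=> [a | a a' b /step_rigid Ha /step_rigid Ha' | b].
- by exists (a + 1)%Z; split=> [| c /step_rigid]; first exact/step_rigid.
- lia.
- by exists (b - 1)%Z; apply/step_rigid; lia.
Qed.

(* Distinct marks are at least N+2 steps apart. *)
Lemma rigid_no_marked_path j : 0 < j <= N.+1 -> no_marked_path R rigid_model j.
Proof.
move=> /andP [/ltP Hj0 /leP Hj] [a [b [/marked_rigid [p [Hp ->]]]]].
move=> /marked_rigid [q [Hq ->]] /step_path_rigid E.
have : (gap * (q - p) = Z.of_nat j)%Z by lia.
rewrite /gap; case: (Z_lt_le_dec 0 (q - p)); nia.
Qed.

(* The marks are unbounded above. *)
Lemma rigid_more_marks k : more_marks R rigid_model k.
Proof.
move=> p _; have [B HB] : exists B, forall j, j < k -> (p j <= B)%Z.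
  elim: k => [|k [B HB]]; first by exists 0%Z.
  by exists (Z.max B (p k)) => j; rewrite ltnS leq_eqVlt => /orP [/eqP -> | /HB]; lia.
exists (gap * (Z.abs B + 1))%Z; split.
- by apply/marked_rigid; exists (Z.abs B + 1)%Z; split=> //; lia.
- by move=> j /HB; rewrite /gap; nia.
Qed.

Lemma rigid_chain_axiom k : k <= N -> fo_sat rigid_model (chain_axiom R k).
Proof.
move=> Hk; apply/sat_chain_axiom; split.
- exact: rigid_step_bijective.
- exact: rigid_no_marked_path.
- exact: rigid_more_marks.
Qed.

Lemma rigid_shape : R_shaped R rigid_model.
Proof.
split=> [f | s Hs f [E _] //].
by split=> -[_ [i [j [Hi Hj H]]]]; split=> //; exists i, j; split=> //;
   move: H; rewrite /= /pair_tuple Hi Hj.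
Qed.

(* An automorphism commutes with the successor, so it is a translation; since
   it preserves the set of marks, which is bounded below, it is the identity. *)
Lemma rigid_model_rigid (a : aut rigid_model) (x : Z) : pfun (aperm a) x = x.
Proof.
set pi := pfun (aperm a).
have pi_inj : injective pi := can_inj (pK (aperm a)).
have pi_edge x' y : Zedge x' y <-> Zedge (pi x') (pi y).
  by rewrite -!edge_rigid /edge (apres a R (pair_tuple x' y)) pair_tuple_comp.
have pi_succ y : pi (y + 1)%Z = (pi y + 1)%Z.
  have : Zedge y (y + 1)%Z by left.
  by move/pi_edge => [// | [/pi_inj E _]]; lia.
have pi_mark y : on_mark y <-> on_mark (pi y).
  have loop_mark z : Zedge z z -> on_mark z by case=> [| []]; [lia | ].
  split=> Hy; apply: loop_mark; [apply/(pi_edge y y) | apply/(pi_edge y y)]; by right.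
have pi_shift y : pi y = (pi 0 + y)%Z.
  elim/Z.peano_ind: y => [| y IH | y IH]; first lia.
  - by rewrite -Z.add_1_r pi_succ IH; lia.
  - by move: (pi_succ (Z.pred y)); rewrite Z.add_1_r Z.succ_pred IH; lia.
have mark_ge0 y : on_mark y -> (0 <= y)%Z.
  by case=> q [Hq ->]; apply: Z.mul_nonneg_nonneg => //; rewrite /gap; lia.
have H0 : (0 <= pi 0)%Z by apply/mark_ge0/(pi_mark 0%Z); exists 0%Z; lia.
have H1 : (0 <= - pi 0)%Z.
  by apply/mark_ge0/(pi_mark (- pi 0%Z)%Z); rewrite pi_shift; exists 0%Z; split; lia.
by rewrite pi_shift; lia.
Qed.

End RigidModels.

Section ChainModels.
Variable sg : signature.
Variable R : sym sg.
Hypothesis HR : 1 < arity R.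
Variable A : structure sg.
Hypothesis A_bijective : step_bijective R A.
Hypothesis A_no_path : forall j, no_marked_path R A j.+1.
Hypothesis A_marks : forall k, more_marks R A k.
Hypothesis A_shape : R_shaped R A.

Let inhA := dom_inh A.

Definition next (a : A) : A := epsilon inhA (fun b => step R a b).
Definition prev (b : A) : A := epsilon inhA (fun a => step R a b).

Lemma step_next a : step R a (next a).
Proof.
case: A_bijective => Hf _ _; case: (Hf a) => b [Hb _].
exact: epsilon_spec inhA _ (ex_intro _ b Hb).
Qed.

Lemma step_prev b : step R (prev b) b.
Proof.
case: A_bijective => _ _ Hs; case: (Hs b) => a Ha.
exact: epsilon_spec inhA (fun a => step R a b) (ex_intro _ a Ha).
Qed.

Lemma stepE a b : step R a b <-> b = next a.
Proof.
split=> [Hab | ->]; last exact: step_next.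
case: A_bijective => Hf _ _; case: (Hf a) => c [_ Hc].
by rewrite (Hc _ Hab) (Hc _ (step_next a)).
Qed.

Lemma nextK b : next (prev b) = b.
Proof. by symmetry; apply/stepE; exact: step_prev. Qed.

Lemma prevK a : prev (next a) = a.
Proof. by case: A_bijective => _ Hi _; apply: Hi (step_prev _) (step_next a). Qed.

Lemma step_pathE j (a b : A) : step_path R j a b <-> b = iter j next a.
Proof.
elim: j a b => [|j IH] a b /=; first by split=> ->.
split=> [[c [/stepE -> /IH ->]] | ->]; first by rewrite -iterSr.
by exists (next a); split; [exact/stepE | apply/IH; rewrite -iterS iterSr].
Qed.

Definition shift (z : Z) (x : A) : A :=
  if (0 <=? z)%Z then iter (Z.to_nat z) next x else iter (Z.to_nat (- z)) prev x.

Lemma shift_nat n x : shift (Z.of_nat n) x = iter n next x.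
Proof. by rewrite /shift (proj2 (Z.leb_le _ _) (Nat2Z.is_nonneg n)) Nat2Z.id. Qed.

Lemma shift_succ z x : shift (z + 1) x = next (shift z x).
Proof.
rewrite /shift; case: (Z.leb_spec 0 z) => Hz.
- rewrite (proj2 (Z.leb_le _ _) (_ : (0 <= z + 1)%Z)); last lia.
  by rewrite (_ : Z.to_nat (z + 1) = (Z.to_nat z).+1) //; lia.
- case: (Z.leb_spec 0 (z + 1)) => Hz1.
  + have -> : z = (-1)%Z by lia.
    by rewrite /= nextK.
  + by rewrite (_ : Z.to_nat (- z) = (Z.to_nat (- (z + 1))).+1) /= ?nextK //; lia.
Qed.

Lemma shift_pred z x : shift (z - 1) x = prev (shift z x).
Proof. by rewrite -{2}(Z.sub_add 1 z) shift_succ prevK. Qed.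

Lemma shift_add a b x : shift (a + b) x = shift a (shift b x).
Proof.
elim/Z.peano_ind: a => [// | a IH | a IH].
- by rewrite -Z.add_1_r (_ : (a + 1 + b = a + b + 1)%Z) ?shift_succ ?IH //; lia.
- by rewrite -Z.sub_1_r (_ : (a - 1 + b = a + b - 1)%Z) ?shift_pred ?IH //; lia.
Qed.

Lemma shiftK z x : shift (- z) (shift z x) = x.
Proof. by rewrite -shift_add Z.add_opp_diag_l. Qed.

Lemma shift_marked z x : marked R x -> marked R (shift z x) -> z = 0%Z.
Proof.
have no_loop n y : marked R y -> marked R (iter n.+1 next y) -> False.
  by move=> Hy Hny; apply: (A_no_path (j := n)); exists y, (iter n.+1 next y);
     split=> //; apply/step_pathE.
move=> Hx Hzx; case: (Z.lt_total z 0) => [Hz | [// | Hz]]; exfalso.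
- have [m Em] : exists m, (- z = Z.of_nat m.+1)%Z.
    by exists (Z.to_nat (- z) - 1)%coq_nat; lia.
  by apply: (no_loop m _ Hzx); rewrite -shift_nat -Em shiftK.
- have [m Em] : exists m, z = Z.of_nat m.+1 by exists (Z.to_nat z - 1)%coq_nat; lia.
  by apply: (no_loop m _ Hx); rewrite -shift_nat -Em.
Qed.

Definition fresh_mark k (p : nat -> A) : A :=
  epsilon inhA (fun a => marked R a /\ forall j, j < k -> a <> p j).

Fixpoint marks_prefix k : nat -> A :=
  if k is k'.+1 then fun i => if i == k' then fresh_mark k' (marks_prefix k') else marks_prefix k' i
  else fun i => epsilon inhA (fun _ => True).

Definition mark_seq i := fresh_mark i (marks_prefix i).

Lemma marks_prefixE k i : i < k -> marks_prefix k i = mark_seq i.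
Proof.
elim: k => [// | k IH] /=; rewrite ltnS leq_eqVlt.
by case: eqP => [-> | Hne] //= Hi; apply: IH; rewrite ltn_neqAle Hi andbT; apply/eqP.
Qed.

Lemma mark_seq_spec i : marked R (mark_seq i) /\ forall j, j < i -> mark_seq i <> mark_seq j.
Proof.
elim/ltn_ind: i => i IH.
have Hprefix j : j < i -> marked R (marks_prefix i j).
  by move=> Hj; rewrite marks_prefixE //; case: (IH j Hj).
have [a Ha] := A_marks Hprefix.
have [Hm Hd] := epsilon_spec inhA
  (fun a => marked R a /\ forall j, j < i -> a <> marks_prefix i j) (ex_intro _ a Ha).
by split=> // j Hj; rewrite -(marks_prefixE Hj); exact: Hd.
Qed.

Lemma mark_seq_inj : injective mark_seq.
Proof.
move=> i j E; case: (ltngtP i j) => // H; exfalso.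
- by case: (mark_seq_spec j) => _ /(_ i H); rewrite E.
- by case: (mark_seq_spec i) => _ /(_ j H).
Qed.

Definition chain_point (p : nat * Z) : A := shift p.2 (mark_seq p.1).

(* Distinct coordinates give distinct points, since two marks never share an
   orbit; the marked points are those at distance 0 from their mark. *)
Lemma chain_point_inj : injective chain_point.
Proof.
move=> [k z] [k' z'] /=; rewrite /chain_point /= => E.
have E1 : shift (z - z') (mark_seq k) = mark_seq k'.
  by rewrite (_ : (z - z' = - z' + z)%Z) ?shift_add ?E ?shiftK //; lia.
have Hz : (z - z')%Z = 0%Z.
  by apply: (shift_marked (proj1 (mark_seq_spec k))); rewrite E1; case: (mark_seq_spec k').
have Hk : k = k' by apply: mark_seq_inj; rewrite -E1 Hz.
by rewrite Hk (_ : z = z') //; lia.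
Qed.

Lemma chain_point_marked p : marked R (chain_point p) <-> p.2 = 0%Z.
Proof.
have Hm k := proj1 (mark_seq_spec k).
case: p => k z; rewrite /chain_point /=.
by split=> [/(shift_marked (Hm k)) | ->] //; exact: Hm.
Qed.

Lemma chain_point_next p : next (chain_point p) = chain_point (p.1, p.2 + 1)%Z.
Proof. by rewrite /chain_point /= shift_succ. Qed.

(* Permuting the indices of the marks moves whole orbits. *)
Definition on_chain (x : A) := exists p, x = chain_point p.
Definition chain_coord (x : A) : nat * Z :=
  epsilon (inhabits (0, 0%Z)) (fun p => x = chain_point p).

Definition chain_perm (s : nat -> nat) (x : A) : A :=
  if excluded_middle_informative (on_chain x)
  then chain_point (s (chain_coord x).1, (chain_coord x).2) else x.

Lemma chain_perm_point s p : chain_perm s (chain_point p) = chain_point (s p.1, p.2).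
Proof.
rewrite /chain_perm; case: (excluded_middle_informative _) => [Hp | []]; last by exists p.
suff -> : chain_coord (chain_point p) = p by [].
symmetry; apply: chain_point_inj.
exact: epsilon_spec _ (fun q => chain_point p = chain_point q) (ex_intro _ p erefl).
Qed.

Lemma chain_perm_out s x : ~ on_chain x -> chain_perm s x = x.
Proof. by rewrite /chain_perm; case: (excluded_middle_informative _). Qed.

Lemma chain_perm_comp s t x : chain_perm s (chain_perm t x) = chain_perm (s \o t) x.
Proof.
case: (classic (on_chain x)) => [[p ->] | Hx]; first by rewrite !chain_perm_point.
by rewrite !chain_perm_out.
Qed.

Lemma chain_perm_id s x : s =1 id -> chain_perm s x = x.
Proof.
move=> Hs; case: (classic (on_chain x)) => [[[k z] ->] | Hx]; last exact: chain_perm_out.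
by rewrite chain_perm_point /= Hs.
Qed.

Lemma chain_perm_next s x : chain_perm s (next x) = next (chain_perm s x).
Proof.
case: (classic (on_chain x)) => [[p ->] | Hx].
- by rewrite chain_point_next !chain_perm_point chain_point_next.
- rewrite !chain_perm_out // => -[[k z] Ep]; apply: Hx; exists (k, z - 1)%Z.
  by rewrite -(prevK x) Ep /chain_point /= shift_pred.
Qed.

Lemma chain_perm_marked s x : marked R (chain_perm s x) <-> marked R x.
Proof.
case: (classic (on_chain x)) => [[p ->] | Hx]; last by rewrite chain_perm_out.
by rewrite chain_perm_point !chain_point_marked.
Qed.

Lemma edgeE (x y : A) : edge R x y <-> (x <> y /\ y = next x) \/ (x = y /\ marked R x).
Proof.
case: (classic (x = y)) => [<- | Hne]; first by split=> [| [[] | []]]; [right | |].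
by rewrite -stepE /step; split=> [| [[_ []] | []]]; [left | |].
Qed.

Lemma chain_permK s t : cancel s t -> cancel (chain_perm s) (chain_perm t).
Proof. by move=> sK x; rewrite chain_perm_comp chain_perm_id. Qed.

Lemma chain_perm_edge s t : cancel s t ->
  forall x y, edge R x y <-> edge R (chain_perm s x) (chain_perm s y).
Proof.
move=> /chain_permK /can_inj sinj x y; rewrite !edgeE chain_perm_marked -chain_perm_next.
split=> [[[Hne Ey] | [<- Hm]] | [[Hne /sinj Ey] | [/sinj <- Hm]]]; try by right.
- by subst y; left; split=> // E; exact: Hne (sinj _ _ E).
- by subst y; left; split=> // E; apply: Hne; rewrite -E.
Qed.

(* Since R is binary-shaped and the other symbols are empty, preserving edges
   means preserving all relations. *)
Lemma chain_perm_interp s t : cancel s t ->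
  forall (r : sym sg) (u : 'I_(arity r) -> A), interp A r u <-> interp A r (chain_perm s \o u).
Proof.
move=> sK r u; case: (classic (r = R)) => [Er | Hr]; last first.
  by case: A_shape => _ /(_ r Hr) /empty_symbolE Hemp; split=> /Hemp.
subst r; case: A_shape => /(binary_shapedE HR) Hsh _; rewrite (Hsh u) (Hsh (_ \o u)).
exact: chain_perm_edge sK _ _.
Qed.

Definition chain_aut (p : perm_of nat) : aut A :=
  @Aut sg A (@Perm A _ _ (chain_permK (pK p)) (chain_permK (pKV p))) (chain_perm_interp (pK p)).

Lemma S_omega_embeds : has_subgroup_iso_to (Aut_group A) S_omega.
Proof.
exists chain_aut; split.
- by move=> p q; apply: aut_ext; apply: perm_ext => x /=; rewrite chain_perm_comp.
- move=> p q E; apply: perm_ext => n.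
  have := f_equal (fun a : aut A => pfun (aperm a) (chain_point (n, 0%Z))) E.
  by rewrite /= !chain_perm_point => /chain_point_inj [].
Qed.

End ChainModels.

Lemma countable_range (T I : Type) (c : I -> nat) (f : I -> T) :
  injective c -> countable_set (fun y => exists i, y = f i).
Proof.
move=> c_inj.
pose pre y := if excluded_middle_informative (exists i, y = f i) is left H
              then Some (proj1_sig (constructive_indefinite_description _ H)) else None.
have pre_spec y : (exists i, y = f i) -> exists i, pre y = Some i /\ y = f i.
  rewrite /pre; case: (excluded_middle_informative _) => [H _ | //].
  by case: (constructive_indefinite_description _ H) => i /= Hi; exists i.
exists (fun y => if pre y is Some i then c i else 0) => y y' Hy Hy'.
by case/pre_spec: Hy => i [-> ->]; case/pre_spec: Hy' => i' [-> ->] /c_inj ->.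
Qed.

Lemma eventually_in_list (T : Type) (Q : T -> nat -> Prop) (l : list T) :
  (forall x, in_list x l -> exists N0, forall N, N0 <= N -> Q x N) ->
  exists N0, forall x, in_list x l -> forall N, N0 <= N -> Q x N.
Proof.
elim: l => [| y l IH] Hl; first by exists 0.
have [N1 HN1] := Hl y (or_introl erefl).
have [N2 HN2] := IH (fun x Hx => Hl x (or_intror Hx)).
exists (maxn N1 N2) => x [-> | Hx] N HN; first by apply: HN1; exact: leq_trans (leq_maxl _ _) HN.
by apply: HN2 => //; exact: leq_trans (leq_maxr _ _) HN.
Qed.

Section SeparatingTheory.
Variable sg : signature.
Variable P : structure sg -> Prop.
Variables (I : Type) (index_code : I -> nat).
Hypothesis index_code_inj : injective index_code.
Variable ax : I -> fo_formula sg.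
Hypothesis ax_closed : forall i, fo_sentence (ax i).
Variable M : nat -> structure sg.
Hypothesis M_in_P : forall N, P (M N).
Hypothesis M_eventually : forall i, exists N0, forall N, N0 <= N -> fo_sat (M N) (ax i).
Hypothesis models_outside_P : forall A, (forall i, fo_sat A (ax i)) -> ~ P A.

(* A nonprincipal ultraproduct of the M N satisfies every ax i, but it would
   also satisfy a first-order definition of P. *)
Lemma separated_not_fo_expressible : ~ fo_expressible P.
Proof.
case=> phi [_ Hphi]; have [U U_tails] := nonprincipal_ultrafilter.
apply: (models_outside_P (A := ultraproduct M U)).
- move=> i; apply: Los_sat; have [N0 HN0] := M_eventually i.
  exact: U_mono (U_tails N0).
- by apply/Hphi/Los_sat; apply: U_mono (U_full U) => N _; apply/Hphi.
Qed.

Lemma separated_bad_set (L : abstract_logic sg) (th : lsent L) :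
  fo_le L -> (forall A, lsat L A th <-> P A) ->
  exists G : lsent L -> Prop,
    [/\ countable_set G, finitely_satisfiable G, ~ satisfiable G & G th].
Proof.
move=> HL Hth.
pose tr i := epsilon (inhabits th) (fun psi => forall A, lsat L A psi <-> fo_sat A (ax i)).
have trE i A : lsat L A (tr i) <-> fo_sat A (ax i).
  have [psi Hpsi] := HL _ (@ax_closed i).
  move: A; exact: epsilon_spec (inhabits th)
    (fun psi => forall A, lsat L A psi <-> fo_sat A (ax i)) (ex_intro _ psi Hpsi).
pose sep o := if o is Some i then tr i else th.
have sep_eventually o : exists N0, forall N, N0 <= N -> lsat L (M N) (sep o).
  case: o => [i | ]; last by exists 0 => N _; apply/Hth.
  by have [N0 HN0] := M_eventually i; exists N0 => N /HN0 /trE.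
exists (fun psi => exists o, psi = sep o); split; last by exists None.
- apply: countable_range (fun o => if o is Some i then (index_code i).+1 else 0) _ _.
  by case=> [i | ] [j | ] //= [/index_code_inj ->].
- move=> l Hl.
  have [N0 HN0] : exists N0, forall psi, in_list psi l -> forall N, N0 <= N -> lsat L (M N) psi.
    by apply: eventually_in_list => psi /Hl [o ->]; exact: sep_eventually.
  by exists (M N0) => psi /HN0; apply.
- case=> A HA; apply: (models_outside_P (A := A)).
  + by move=> i; apply/trE/HA; exists (Some i).
  + by apply/Hth/HA; exists None.
Qed.

End SeparatingTheory.

(* With a sound and complete proof system, a negation-closed logic is compact:
   an unsatisfiable set entails the negation of its member th, hence a finite
   part of it proves that negation, and together with th that part has no model. *)
Lemma sound_complete_compact (sg : signature) (L : abstract_logic sg) (PS : proof_system L) :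
  neg_closed L -> ps_sound PS -> ps_complete PS ->
  forall (G : lsent L -> Prop) (th : lsent L),
    G th -> finitely_satisfiable G -> satisfiable G.
Proof.
move=> Hneg Hsound Hcomplete G th Gth Gfin; apply: NNPP => Gunsat.
have [nth Hnth] := Hneg th.
have [pi [Hconcl Hprem]] : exists pi : proofs PS, conclusion pi = nth /\
    forall phi, in_list phi (premisses pi) -> G phi.
  by apply: (Hcomplete G nth) => A HA; case: Gunsat; exists A.
have [A HA] : exists A, forall phi, in_list phi (cons th (premisses pi)) -> lsat L A phi.
  by apply: Gfin => phi [-> | /Hprem].
apply/(Hnth A): (HA th (or_introl erefl)).
by rewrite -Hconcl; apply: Hsound => phi Hphi; exact: HA (or_intror Hphi).
Qed.

Lemma embeds_iso (G H K : group) :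
  has_subgroup_iso_to G K -> group_isomorphic G H -> has_subgroup_iso_to H K.
Proof.
move=> [k [k_hom k_inj]] [h [h_hom [h' hK _]]].
exists (h \o k); split=> [x y | x y /= /(can_inj hK) /k_inj //].
by rewrite /= k_hom h_hom.
Qed.

Lemma sum_code_inj (T : Type) (c : T -> nat) : injective c ->
  injective (fun i : nat + T => match i with inl k => k.*2 | inr t => (c t).*2.+1 end).
Proof.
move=> c_inj [k | s] [k' | s'] /= E.
- by rewrite (double_inj E).
- by move/(congr1 odd): E; rewrite /= !odd_double.
- by move/(congr1 odd): E; rewrite /= !odd_double.
- by rewrite (c_inj _ _ (double_inj (succn_inj E))).
Qed.

Section AutomorphismClass.
Variable sg : signature.
Variable R : sym sg.
Hypothesis HR : 1 < arity R.
Variable C : group -> Prop.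
Hypothesis C_no_S_omega : forall G : group, C G -> ~ has_subgroup_iso_to G S_omega.
Hypothesis C_trivial : exists G : group, C G /\ forall x y : G, x = y.

Definition sep_axiom (i : nat + sym sg) : fo_formula sg :=
  match i with inl k => chain_axiom R k | inr s => shape_axiom R s end.

Lemma closed_sep_axiom i : fo_sentence (sep_axiom i).
Proof. by case: i => [k | s]; [apply: closed_chain_axiom | apply: closed_shape_axiom]. Qed.

Lemma rigid_in_class (A : structure sg) :
  (forall (a : aut A) x, pfun (aperm a) x = x) -> aut_in_class sg C A.
Proof.
move=> A_rigid; case: C_trivial => G [CG G_triv]; exists G; split=> //.
exists (fun _ => gone G); split=> [x y | ]; first exact: G_triv.
exists (fun _ => aut_one A) => [a | g]; last exact: G_triv.
by apply: aut_ext; apply: perm_ext => x; rewrite A_rigid.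
Qed.

Lemma rigid_models_in_class N : aut_in_class sg C (rigid_model R N).
Proof. by apply: rigid_in_class; exact: rigid_model_rigid. Qed.

Lemma rigid_eventually i :
  exists N0, forall N, N0 <= N -> fo_sat (rigid_model R N) (sep_axiom i).
Proof.
case: i => [k | s]; first by exists k => N; exact: rigid_chain_axiom.
by exists 0 => N _; apply: (proj2 (sat_shape_axioms R _)); exact: rigid_shape.
Qed.

Lemma sep_models_outside (A : structure sg) :
  (forall i, fo_sat A (sep_axiom i)) -> ~ aut_in_class sg C A.
Proof.
move=> HA [G [CG AutA_G]]; apply: (C_no_S_omega CG); apply: embeds_iso AutA_G.
have /sat_shape_axioms A_shape : forall s, fo_sat A (shape_axiom R s).
  by move=> s; exact: HA (inr s).
have A_chain k := proj1 (sat_chain_axiom R A k) (HA (inl k)).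
apply: (S_omega_embeds HR) A_shape.
- by case: (A_chain 0).
- by move=> j; case: (A_chain j).
- by move=> k; case: (A_chain k).
Qed.

Lemma aut_class_bad_set (code : sym sg -> nat) (L : abstract_logic sg) (th : lsent L) :
  injective code -> fo_le L -> (forall A, lsat L A th <-> aut_in_class sg C A) ->
  exists G : lsent L -> Prop,
    [/\ countable_set G, finitely_satisfiable G, ~ satisfiable G & G th].
Proof.
move=> /sum_code_inj code_inj.
exact: (separated_bad_set code_inj closed_sep_axiom rigid_models_in_class rigid_eventually
          sep_models_outside).
Qed.

End AutomorphismClass.

Theorem mainTheorem4 (sg : signature)
  (Hcount : exists f : sym sg -> nat, injective f)
  (R : sym sg) (HR : 2 <= arity R)
  (C : group -> Prop)
  (HnoS : forall G : group, C G -> ~ has_subgroup_iso_to G S_omega)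
  (Htriv : exists G : group, C G /\ forall x y : G, x = y) :
  ~ fo_expressible (aut_in_class sg C) /\
  (forall L : abstract_logic sg,
     fo_le L -> expresses L (aut_in_class sg C) -> ~ aleph0_compact L) /\
  (forall L : abstract_logic sg,
     fo_le L -> expresses L (aut_in_class sg C) -> neg_closed L ->
     ~ exists PS : proof_system L, ps_sound PS /\ ps_complete PS).
Proof.
case: Hcount => code code_inj; split; [| split].
- exact: (separated_not_fo_expressible (rigid_models_in_class HR Htriv) (rigid_eventually HR)
            (sep_models_outside HR HnoS)).
- move=> L HL [th Hth] L_compact.
  have [G [G_count G_fin G_unsat _]] := aut_class_bad_set HR HnoS Htriv code_inj HL Hth.
  exact: G_unsat (L_compact G G_count G_fin).
- move=> L HL [th Hth] L_neg [PS [PS_sound PS_complete]].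
  have [G [_ G_fin G_unsat G_th]] := aut_class_bad_set HR HnoS Htriv code_inj HL Hth.
  exact: G_unsat (sound_complete_compact L_neg PS_sound PS_complete G_th G_fin).
Qed.
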